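(* Consider the descriptor system $Ex_{k+1}=Ax_k+Bu_k+w_k$, $y_{k+1}=Hx_{k+1}+v_k$ with $E,A\in\mathbb{R}^{n_1\times n}$, $H\in\mathbb{R}^{m\times n}$, where $\begin{bmatrix}E&A\end{bmatrix}$ has full row rank, $\begin{bmatrix}E^T&H^T\end{bmatrix}^T$ has full column rank, and $P_0,Q,R$ are symmetric positive definite. Suppose the system is detectable and stabilizable (as defined in the context). Let $P_k^{(+)}$ and $\Gamma_k^{sm}$ be as defined in the context, and for integers $b\ge0$, $c\ge1$ define $M_1^{(b)}=I$ and $M_q^{(b)}=M_{q-1}^{(b)}\,\Gamma^{sm}_{b+q-1}A^TQ^{-1}E$ for $q=2,\dots,c$. Then $$\big\|(\Gamma_{b+1}^{sm})^{-1}M_c^{(b)}\big\|_{i2}\to0\quad\text{as } c\to\infty \text{ and } b\to\infty,$$ where $\|\cdot\|_{i2}$ is the matrix norm induced by the Euclidean norm.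
   Context: Recursion: $P_0^{(+)}=P_0$, $P_0^{(-)}=AP_0A^T+Q$, and for $k\ge1$: $P_k^{(+)}=(E^T(P_{k-1}^{(-)})^{-1}E+H^TR^{-1}H)^{-1}$, $P_k^{(-)}=AP_k^{(+)}A^T+Q$; and $\Gamma_k^{sm}=((P_k^{(+)})^{-1}+A^TQ^{-1}A)^{-1}$. Detectability: $\mathrm{rank}\begin{bmatrix}\mu E-\phi A\\ H\end{bmatrix}=n$ for all complex pairs $(\mu,\phi)\neq(0,0)$ with $|\mu|\ge|\phi|$. Stabilizability: $\mathrm{rank}\begin{bmatrix}\mu E-\phi A & Q & 0\\ \mu H & 0 & R\end{bmatrix}=n_1+m$ for almost all complex pairs $(\mu,\phi)\neq(0,0)$ with $|\mu|\ge|\phi|$. *)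

(* Defs.v *)
From HB Require Import structures.
From mathcomp Require Import all_boot all_order all_algebra.
From mathcomp Require Import complex.
From mathcomp Require Import all_classical all_reals.
Set Implicit Arguments. Unset Strict Implicit. Unset Printing Implicit Defensive.
Import Order.TTheory GRing.Theory Num.Theory.
Local Open Scope ring_scope.
Local Open Scope classical_set_scope.

Section Defs.
Variable R : realType.

Definition sym_posdef n (P : 'M[R]_n) : Prop :=
  P^T = P /\ forall x : 'cV[R]_n, x != 0 -> 0 < (x^T *m P *m x) 0 0.

Definition enorm p (x : 'cV[R]_p) : R := Num.sqrt (\sum_i (x i 0) ^+ 2).

Definition i2norm p q (M : 'M[R]_(p, q)) : R :=
  sup [set enorm (M *m x) | x in [set x : 'cV[R]_q | enorm x = 1]].

Definition cmx p q (M : 'M[R]_(p, q)) : 'M[R[i]]_(p, q) :=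
  map_mx (fun x : R => Complex x 0) M.

Variables (n1 n m : nat).
Variables (E A : 'M[R]_(n1, n)) (H : 'M[R]_(m, n)).
Variables (P0 : 'M[R]_n) (Q : 'M[R]_n1) (Rm : 'M[R]_m).

Definition detectable : Prop :=
  forall mu phi : R[i], (mu, phi) != (0, 0) -> `|phi| <= `|mu| ->
    \rank (col_mx (mu *: cmx E - phi *: cmx A) (cmx H)) = n.

Definition stab_rank (mu phi : R[i]) : Prop :=
  \rank (block_mx (mu *: cmx E - phi *: cmx A) (row_mx (cmx Q) (0 : 'M_(n1, m)))
                  (mu *: cmx H) (row_mx (0 : 'M_(m, n1)) (cmx Rm))) = (n1 + m)%N.

(* Stabilizability: the rank condition holds for almost all admissible pairs,
   i.e. the exceptional pairs lie on finitely many complex lines through 0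
   (the condition is invariant under nonzero complex scaling). *)
Definition stabilizable : Prop :=
  exists s : seq (R[i] * R[i]),
    forall mu phi : R[i], (mu, phi) != (0, 0) -> `|phi| <= `|mu| ->
      ~ stab_rank mu phi ->
      exists2 p, p \in s & exists t : R[i], mu = t * p.1 /\ phi = t * p.2.

Fixpoint Ppm (k : nat) : 'M[R]_n * 'M[R]_n1 :=
  match k with
  | 0 => (P0, A *m P0 *m A^T + Q)
  | k'.+1 =>
      let Pp := invmx (E^T *m invmx (Ppm k').2 *m E + H^T *m invmx Rm *m H) in
      (Pp, A *m Pp *m A^T + Q)
  end.

Definition Pplus k := (Ppm k).1.
Definition Pminus k := (Ppm k).2.

Definition Gamma_sm k : 'M[R]_n :=
  invmx (invmx (Pplus k) + A^T *m invmx Q *m A).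

(* Mseq b (q-1) = M_q^(b):  M_1 = I, M_q = M_{q-1} Gamma_{b+q-1} A^T Q^-1 E *)
Fixpoint Mseq (b j : nat) : 'M[R]_n :=
  match j with
  | 0 => 1%:M
  | j'.+1 => Mseq b j' *m Gamma_sm (b + j'.+1) *m A^T *m invmx Q *m E
  end.

Definition Mmat (b c : nat) : 'M[R]_n := Mseq b c.-1.

End Defs.

(* Main.v *)
Require Import Defs.
From HB Require Import structures.
From mathcomp Require Import all_boot all_order all_algebra.
From mathcomp Require Import complex.
From mathcomp Require Import all_classical all_reals.
From mathcomp Require Import ring lra zify.
From mathcomp Require Import normedtype sequences.
Import Order.TTheory GRing.Theory Num.Theory.
Import numFieldNormedType.Exports.
Local Open Scope ring_scope.

(* Put V_k(x) = x^T (P_k^(+))^-1 x and G_k = Gamma_k^sm A^T Q^-1 E.  Completing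
   the square gives the dynamic programming identity
     V_{k+1}(x) = V_k(G_k x) + |E x - A G_k x|^2_{Q^-1} + |H x|^2_{R^-1},
   so V_k(x) dominates the residuals E x_{j+1} - A x_j and H x_{j+1} of a whole
   trajectory x_0, ..., x_k = x.  Detectability forces trajectories with small
   residuals to be small, uniformly in k, hence |x|^2 <= c V_k(x).  Moreover
   V_k(G_k x) = <G_k x, A^T Q^-1 w> with w = E x - A G_k x, so by Cauchy-Schwarz
   V_k(G_k x) is at most a constant times |w|^2_{Q^-1}, and V_k(G_k x) <=
   t V_{k+1}(x) with t < 1 independent of k.  As M_c^(b) is the product
   G_{b+1} ... G_{b+c-1}, it decays like t^(c/2), uniformly in b. *)

Set Implicit Arguments.
Unset Strict Implicit.

(** * Entrywise bounds on vectors *)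

(** A sup-norm bound as a predicate over any [numDomainType], usable over both the reals and the
    complex numbers, where eigenvalues live. *)
Definition entry_le (K : numDomainType) p (r : K) (y : 'cV[K]_p) :=
  forall i, `|y i 0| <= r.

Lemma entry_le_trans (K : numDomainType) p (r s : K) (y : 'cV[K]_p) :
  r <= s -> entry_le r y -> entry_le s y.
Proof. by move=> rs yr i; apply: le_trans (yr i) rs. Qed.

Lemma entry_leD (K : numDomainType) p (r s : K) (y z : 'cV[K]_p) :
  entry_le r y -> entry_le s z -> entry_le (r + s) (y + z).
Proof.
by move=> yr zs i; rewrite mxE (le_trans (ler_normD _ _)) // lerD.
Qed.

Lemma entry_leZ (K : numDomainType) p (a r : K) (y : 'cV[K]_p) :
  entry_le r y -> entry_le (`|a| * r) (a *: y).
Proof. by move=> yr i; rewrite mxE normrM ler_wpM2l. Qed.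

Lemma entry_leM (K : numDomainType) p q (M : 'M[K]_(p, q)) :
  exists2 c : K, 0 <= c &
    forall r (y : 'cV_q), 0 <= r -> entry_le r y -> entry_le (c * r) (M *m y).
Proof.
have cols_ge0 i : 0 <= \sum_j `|M i j| by apply: sumr_ge0.
exists (\sum_i \sum_j `|M i j|) => [|r y r0 yr i]; first exact: sumr_ge0.
rewrite mxE (le_trans (ler_norm_sum _ _ _)) //.
rewrite (bigD1 i) //= mulrDl.
apply: (@le_trans _ _ ((\sum_j `|M i j|) * r)).
  by rewrite mulr_suml; apply: ler_sum => j _; rewrite normrM ler_wpM2l.
by rewrite lerDl mulr_ge0 // sumr_ge0.
Qed.

(** * Detectability bounds trajectories with small residuals *)

Section Detectability.

Variables (K : numClosedFieldType) (n1 n m : nat).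
Variables (E A : 'M[K]_(n1, n)) (H : 'M[K]_(m, n)).

(** Outputs are constrained from time 1 on, as in the terms that V_k collects; at time 0 the state
    itself is bounded. *)
Definition near_trajectory (k : nat) (r : K) (x : nat -> 'cV[K]_n) :=
  [/\ 0 <= r, entry_le r (x 0%N) &
      forall j, (j < k)%N -> entry_le r (E *m x j.+1 - A *m x j) /\
                             entry_le r (H *m x j.+1)].

(* G x_j is controlled by the residuals, except possibly at the last d times:
   the loss d comes from expressing G F x_j through x_{j+1}. *)
Definition tame p (G : 'M[K]_(p, n)) :=
  exists c : K, exists d : nat, 0 <= c /\
    forall k r x, near_trajectory k r x ->
      forall j, (j + d <= k)%N -> entry_le (c * r) (G *m x j).

Lemma tameD p (G1 G2 : 'M[K]_(p, n)) : tame G1 -> tame G2 -> tame (G1 + G2).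
Proof.
move=> [c1 [d1 [c1_0 H1]]] [c2 [d2 [c2_0 H2]]].
exists (c1 + c2), (d1 + d2)%N; split; first exact: addr_ge0.
move=> k r x xr j jk; rewrite mulmxDl mulrDl.
by apply: entry_leD; [apply: (H1 k) | apply: (H2 k)] => //; lia.
Qed.

Lemma tameM p q (M : 'M[K]_(q, p)) (G : 'M[K]_(p, n)) : tame G -> tame (M *m G).
Proof.
move=> [c [d [c0 HG]]]; have [a a0 Ma] := entry_leM M.
exists (a * c), d; split; first exact: mulr_ge0.
move=> k r x xr j jk; rewrite -mulmxA -mulrA.
by have [r0 _ _] := xr; apply: Ma; [rewrite mulr_ge0 | apply: (HG k)].
Qed.

Lemma tameN p (G : 'M[K]_(p, n)) : tame G -> tame (- G).
Proof. by move=> /(tameM (- 1%:M)); rewrite mulNmx mul1mx. Qed.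

Lemma tameZ p (a : K) (G : 'M[K]_(p, n)) : tame G -> tame (a *: G).
Proof. by move=> /(tameM (a%:M)); rewrite mul_scalar_mx. Qed.

Lemma tame_output : tame H.
Proof.
have [a a0 Ha] := entry_leM H.
exists (a + 1), 0%N; split; first exact: addr_ge0.
move=> k r x [r0 x0 xr] [_|j jk]; rewrite mulrDl mul1r.
  by apply: entry_le_trans (Ha _ _ r0 x0); rewrite lerDl.
have jk' : (j < k)%N by lia.
by have [_] := xr j jk'; apply: entry_le_trans; rewrite lerDr mulr_ge0.
Qed.

Variables (Ke : 'M[K]_(n, n1)) (Kh : 'M[K]_(n, m)).
Hypothesis left_inv : Ke *m E + Kh *m H = 1%:M.
Let F := Ke *m A.

(** The left inverse makes the descriptor system explicit: [Ke] and [Kh] applied to the two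
    residuals add up to x_{j+1} - F x_j. *)
Lemma step_residual : exists2 c : K, 0 <= c &
  forall k r x, near_trajectory k r x -> forall j, (j < k)%N ->
    entry_le (c * r) (x j.+1 - F *m x j).
Proof.
have [a a0 Ha] := entry_leM Ke; have [b b0 Hb] := entry_leM Kh.
exists (a + b); first exact: addr_ge0.
move=> k r x [r0 _ xr] j jk; have [Er Hr] := xr j jk.
have -> : x j.+1 - F *m x j = Ke *m (E *m x j.+1 - A *m x j) + Kh *m (H *m x j.+1).
  by rewrite mulmxBr !mulmxA addrAC -mulmxDl left_inv mul1mx.
by rewrite mulrDl; apply: entry_leD; [apply: Ha | apply: Hb].
Qed.

Lemma tame_shift p (G : 'M[K]_(p, n)) : tame G -> tame (G *m F).
Proof.
move=> [c [d [c0 HG]]]; have [a a0 Ha] := entry_leM G.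
have [b b0 Hb] := step_residual.
exists (c + a * b), d.+1; split; first by rewrite addr_ge0 // mulr_ge0.
move=> k r x xr j jk; have [r0 _ _] := xr.
have -> : G *m F *m x j = G *m x j.+1 + G *m (-1 *: (x j.+1 - F *m x j)).
  by rewrite scaleN1r opprB mulmxBr addrC subrK -mulmxA.
rewrite mulrDl -mulrA; apply: entry_leD; first by apply: (HG k) => //; lia.
apply: Ha; first exact: mulr_ge0.
rewrite -[b * r]mul1r -[X in X * _](normrN1 K).
by apply: entry_leZ; apply: (Hb k) => //; lia.
Qed.

(** [E *m F] may differ from [A], but along a near trajectory E F x_j and A x_j are both close to E
    x_{j+1}. *)
Lemma tame_state_residual : tame (E *m F - A).
Proof.
have [a a0 Ha] := entry_leM E; have [b b0 Hb] := step_residual.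
exists (1 + a * b), 1%N; split; first by rewrite addr_ge0 // mulr_ge0.
move=> k r x xr j jk; have [r0 _ xr'] := xr.
have jk' : (j < k)%N by lia.
have [Er _] := xr' j jk'.
have -> : (E *m F - A) *m x j =
    (E *m x j.+1 - A *m x j) + E *m (-1 *: (x j.+1 - F *m x j)).
  by rewrite scaleN1r opprB mulmxBr mulmxBl -mulmxA [RHS]addrC addrA subrK.
rewrite mulrDl mul1r -mulrA; apply: entry_leD => //.
apply: Ha; first exact: mulr_ge0.
rewrite -[b * r]mul1r -[X in X * _](normrN1 K).
by apply: entry_leZ; apply: (Hb k).
Qed.

(* G x_{j+1} = l G x_j + (F - l) G x_j + small: a scalar stable recursion. *)
Lemma tame_stable_factor (l : K) (G : 'M[K]_n) :
  `|l| < 1 -> comm_mx F G -> tame ((F - l%:M) *m G) -> tame G.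
Proof.
move=> l1 FG [c [d [c0 HG]]]; have [a a0 Ha] := entry_leM G.
have [b b0 Hb] := step_residual.
have l0 : 0 < 1 - `|l| by rewrite subr_gt0.
(* Fixed point of the scalar recursion e = |l| e + (c + a b); the extra [a] in the final constant
   covers G x_0. *)
set e := (c + a * b) / (1 - `|l|).
have e0 : 0 <= e by rewrite divr_ge0 ?(ltW l0) // addr_ge0 // mulr_ge0.
have eE : `|l| * e + (c + a * b) = e.
  have : e * (1 - `|l|) = c + a * b by rewrite divfK // gt_eqF.
  by move<-; rewrite mulrBr mulr1 [`|l| * e]mulrC addrC subrK.
exists (a + e), d; split; first exact: addr_ge0.
move=> k r x xr; have [r0 x0 _] := xr; elim=> [_|j IH jk].
  rewrite mulrDl; apply: entry_le_trans (Ha _ _ r0 x0).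
  by rewrite lerDl mulr_ge0.
have -> : G *m x j.+1 =
    l *: (G *m x j) + ((F - l%:M) *m G *m x j + G *m (x j.+1 - F *m x j)).
  rewrite mulmxBr !mulmxBl FG mul_scalar_mx -scalemxAl -mulmxA.
  by rewrite addrA [l *: _ + _]addrC subrK addrC subrK.
apply: (@entry_le_trans _ _ (`|l| * ((a + e) * r) + (c * r + a * (b * r)))).
  rewrite !mulrA -!mulrDl ler_wpM2r // mulrDr -addrA eE lerD2r.
  by rewrite ler_piMl // ltW.
apply: entry_leD; first by apply: entry_leZ; apply: IH; lia.
apply: entry_leD; first by apply: (HG k) => //; lia.
by apply: Ha; [exact: mulr_ge0 | apply: (Hb k) => //; lia].
Qed.

Hypothesis detect : forall l : K, 1 <= `|l| -> \rank (col_mx (l *: E - A) H) = n.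

(* (l E - A) G = (E F - A) G - E (F - l) G, and [l E - A; H] is left invertible. *)
Lemma tame_unstable_factor (l : K) (G : 'M[K]_n) : 1 <= `|l| ->
  tame ((E *m F - A) *m G) -> tame (H *m G) -> tame ((F - l%:M) *m G) -> tame G.
Proof.
move=> l1 tC tH tG.
have /row_fullP[B] : row_full (col_mx (l *: E - A) H) by rewrite /row_full detect.
rewrite -[B]hsubmxK mul_row_col => BE.
have -> : G = lsubmx B *m ((l *: E - A) *m G) + rsubmx B *m (H *m G).
  by rewrite !mulmxA -mulmxDl BE mul1mx.
apply: tameD; last exact: tameM.
apply: tameM.
have -> : (l *: E - A) *m G = (E *m F - A) *m G - E *m ((F - l%:M) *m G).
  rewrite mulmxA -mulmxBl mulmxBr mul_mx_scalar opprB; congr (_ *m _).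
  by rewrite [RHS]addrC addrA subrK.
by apply: tameD => //; apply/tameN/tameM.
Qed.

Definition factor_prod (s : seq K) : 'M[K]_n :=
  foldr (fun l G => (F - l%:M) *m G) 1%:M s.

Lemma comm_factor_prod s : comm_mx F (factor_prod s).
Proof.
elim: s => [|l s IH]; first exact: comm_mx1.
apply: comm_mxM => //; apply: comm_mxB; first exact: comm_mx_refl.
exact: comm_mx_scalar.
Qed.

Lemma tame_mul_factor_prod s p (G : 'M[K]_(p, n)) : tame G -> tame (G *m factor_prod s).
Proof.
elim: s G => [|l s IH] G tG; first by rewrite mulmx1.
rewrite /= mulmxA; apply: IH; rewrite mulmxBr mul_mx_scalar.
by apply: tameD; [exact: tame_shift | apply/tameN/tameZ].
Qed.

(** Strips one linear factor at a time, according to whether |l| < 1. The side conditions of the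
    unstable case hold because E F - A and H are tame and remain so after right multiplication by
    polynomials in F. *)
Lemma tame_id_of_factor_prod s : tame (factor_prod s) -> tame (1%:M : 'M[K]_n).
Proof.
elim: s => [//|l s IH] ts; apply: IH.
have /orP[l1|l1] : (`|l| < 1) || (1 <= `|l|).
- by case: real_ltP => //; rewrite ?normr_real ?real1.
- by apply: (tame_stable_factor l1) => //; exact: comm_factor_prod.
apply: (tame_unstable_factor l1) => //; apply: tame_mul_factor_prod.
  exact: tame_state_residual.
exact: tame_output.
Qed.

(** By Cayley-Hamilton the product of F - l over all eigenvalues l is 0, hence tame; stripping its
    factors leaves the identity. *)
Lemma tame_id : tame (1%:M : 'M[K]_n).
Proof.
have [r rE] := closed_field_poly_normal (char_poly F).
apply: (@tame_id_of_factor_prod r); exists 0, 0%N; split=> // k rho x [rho0 _ _] j _.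
suff -> : factor_prod r = 0 by move=> i; rewrite mul0mx mxE normr0 mul0r.
move: rE; rewrite (monicP (char_poly_monic F)) scale1r /factor_prod.
(* [horner_mx] requires a nonempty matrix, so n = 0 is treated apart. *)
move: F; clear; case: n => [|n'] F rE; first exact: flatmx0.
have := Cayley_Hamilton F; rewrite rE => {rE} CH; rewrite -[RHS]CH.
elim: r {CH} => [|l r IH]; first by rewrite big_nil [RHS]rmorph1.
by rewrite big_cons [RHS]rmorphM rmorphB /= horner_mx_X horner_mx_C IH.
Qed.

(** [tame_id] misses the last d times; they are recovered by running x_{j+1} = F x_j + small
    forward, at most d times, so the constant stays independent of k. *)
Lemma near_trajectory_bounded : exists2 c : K, 0 <= c &
  forall k r x, near_trajectory k r x -> entry_le (c * r) (x k).
Proof.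
have [c [d [c0 Hc]]] := tame_id.
have [b b0 Hb] := step_residual; have [a a0 Ha] := entry_leM F.
(* Here e counts the final times already recovered. *)
suff: forall e, (e <= d)%N -> exists2 c : K, 0 <= c &
    forall k r x, near_trajectory k r x -> forall j, (j + (d - e) <= k)%N ->
      entry_le (c * r) (x j).
  move=> /(_ d (leqnn d))[c' c'0 Hc']; exists c' => // k r x xr.
  by apply: Hc' xr _ _; lia.
elim=> [_|e IH ed].
  by exists c => // k r x xr j jk; rewrite -[x j]mul1mx; apply: (Hc k) => //; lia.
have [c' c'0 Hc'] := IH (ltnW ed).
exists (1 + (b + a * c')); first by rewrite !addr_ge0 // mulr_ge0.
move=> k r x xr j jk; have [r0 x0 _] := xr; rewrite mulrDl mul1r.
case: j jk => [_|j jk].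
  by apply: entry_le_trans x0; rewrite lerDl mulr_ge0 // addr_ge0 // mulr_ge0.
apply: (@entry_le_trans _ _ ((b + a * c') * r)); first by rewrite lerDr.
rewrite -[x j.+1](subrK (F *m x j)) mulrDl -mulrA; apply: entry_leD.
  by apply: (Hb k) => //; lia.
apply: Ha; first exact: mulr_ge0.
by apply: (Hc' k) => //; lia.
Qed.

End Detectability.

(** * Positive definite quadratic forms *)

Section QuadraticForms.

Variable R : realType.

Definition bil p (P : 'M[R]_p) (x y : 'cV[R]_p) : R := (x^T *m P *m y) 0 0.

Lemma bilDl p (P : 'M[R]_p) x y z : bil P (x + y) z = bil P x z + bil P y z.
Proof. by rewrite /bil linearD /= !mulmxDl mxE. Qed.

Lemma bilDr p (P : 'M[R]_p) x y z : bil P x (y + z) = bil P x y + bil P x z.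
Proof. by rewrite /bil mulmxDr mxE. Qed.

Lemma bilZl p (P : 'M[R]_p) a x y : bil P (a *: x) y = a * bil P x y.
Proof. by rewrite /bil linearZ /= -!scalemxAl mxE. Qed.

Lemma bilZr p (P : 'M[R]_p) a x y : bil P x (a *: y) = a * bil P x y.
Proof. by rewrite /bil -scalemxAr mxE. Qed.

Lemma bil0l p (P : 'M[R]_p) y : bil P 0 y = 0.
Proof. by rewrite /bil trmx0 !mul0mx mxE. Qed.

Lemma bil0r p (P : 'M[R]_p) x : bil P x 0 = 0.
Proof. by rewrite /bil mulmx0 mxE. Qed.

Lemma bilT p (P : 'M[R]_p) x y : bil P x y = bil P^T y x.
Proof.
rewrite /bil [LHS](_ : _ = (x^T *m P *m y)^T 0 0); last by rewrite [RHS]mxE.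
by rewrite !trmx_mul trmxK mulmxA.
Qed.

Lemma bilDm p (P S : 'M[R]_p) x y : bil (P + S) x y = bil P x y + bil S x y.
Proof. by rewrite /bil mulmxDr mulmxDl mxE. Qed.

Lemma bil_congr p q (P : 'M[R]_p) (M : 'M[R]_(p, q)) x y :
  bil (M^T *m P *m M) x y = bil P (M *m x) (M *m y).
Proof. by rewrite /bil trmx_mul !mulmxA. Qed.

Definition sqn p (x : 'cV[R]_p) : R := bil 1%:M x x.

Lemma sqnE p (x : 'cV[R]_p) : sqn x = \sum_i x i 0 ^+ 2.
Proof.
by rewrite /sqn /bil mulmx1 mxE; apply: eq_bigr => i _; rewrite mxE expr2.
Qed.

Lemma enormE p (x : 'cV[R]_p) : enorm x = Num.sqrt (sqn x).
Proof. by rewrite sqnE. Qed.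

Lemma sqn_ge0 p (x : 'cV[R]_p) : 0 <= sqn x.
Proof. by rewrite sqnE sumr_ge0 // => i _; rewrite sqr_ge0. Qed.

Lemma sqn_eq0 p (x : 'cV[R]_p) : sqn x = 0 -> x = 0.
Proof.
rewrite sqnE => /eqP; rewrite psumr_eq0 => [/allP x0|i _]; last exact: sqr_ge0.
apply/matrixP => i j; rewrite ord1 mxE; apply/eqP.
by rewrite -sqrf_eq0; apply: x0; rewrite mem_index_enum.
Qed.

Lemma sym_posdef1 p : sym_posdef (1%:M : 'M[R]_p).
Proof.
split=> [|x x0]; first exact: trmx1.
by rewrite lt0r sqn_ge0 andbT; apply: contra x0 => /eqP /sqn_eq0 ->.
Qed.

Lemma posdef_ge0 p (P : 'M[R]_p) x : sym_posdef P -> 0 <= bil P x x.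
Proof.
move=> [_ Ppos]; have [->|x0] := eqVneq x 0; first by rewrite bil0l.
exact: ltW (Ppos _ x0).
Qed.

Lemma bil_sym p (P : 'M[R]_p) x y : sym_posdef P -> bil P x y = bil P y x.
Proof. by move=> [PT _]; rewrite bilT PT. Qed.

Lemma cauchy_schwarz p (P : 'M[R]_p) x y : sym_posdef P ->
  bil P x y ^+ 2 <= bil P x x * bil P y y.
Proof.
move=> Ppd; have [->|y0] := eqVneq y 0.
  by rewrite !bil0r expr0n mulr0.
have ygt0 : 0 < bil P y y by case: Ppd => _; apply.
(* This vector is (y,y) times the part of x that is P-orthogonal to y. *)
have := posdef_ge0 (bil P y y *: x + (- bil P x y) *: y) Ppd.
rewrite !(bilDl, bilDr, bilZl, bilZr) [bil P y x]bil_sym //.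
rewrite (_ : _ + _ = bil P y y * (bil P x x * bil P y y - bil P x y ^+ 2)); last by ring.
by rewrite pmulr_rge0 // subr_ge0.
Qed.

Lemma posdef_unit p (P : 'M[R]_p) : sym_posdef P -> P \in unitmx.
Proof.
move=> [PT Ppos]; rewrite -row_free_unit; apply: inj_row_free => v vP.
apply: contrapT => /eqP v0; have := Ppos v^T.
rewrite trmxK vP mul0mx mxE ltxx => H; suff: false by [].
by apply: H; rewrite trmx_eq0.
Qed.

Lemma posdef_inv p (P : 'M[R]_p) : sym_posdef P -> sym_posdef (invmx P).
Proof.
move=> Ppd; have Pu := posdef_unit Ppd; have [PT Ppos] := Ppd.
have iT : (invmx P)^T = invmx P by rewrite trmx_inv PT.
split=> // x x0; have := Ppos (invmx P *m x).
rewrite trmx_mul iT !mulmxA mulmxKV //; apply.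
by apply: contra x0 => /eqP Px; rewrite -[x](mulKVmx Pu) Px mulmx0.
Qed.

Lemma posdef_congrD p q (P : 'M[R]_p) (S : 'M[R]_q) (M : 'M[R]_(q, p)) :
  sym_posdef P -> sym_posdef S -> sym_posdef (P + M^T *m S *m M).
Proof.
move=> Ppd Spd; split=> [|x x0].
  by rewrite linearD /= !trmx_mul trmxK (proj1 Ppd) (proj1 Spd) mulmxA.
rewrite -[X in 0 < X]/(bil _ x x) bilDm bil_congr ltr_pwDl ?posdef_ge0 //.
exact: (proj2 Ppd).
Qed.

(** The entry x_i is the P-product of x with P^-1 e_i, so Cauchy-Schwarz bounds x_i^2 by (P^-1)_ii
    times the form; the constant is the trace of P^-1. *)
Lemma posdef_coercive p (P : 'M[R]_p) : sym_posdef P ->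
  exists2 c : R, 0 <= c & forall x, sqn x <= c * bil P x x.
Proof.
move=> Ppd; have Pu := posdef_unit Ppd; have iPd := posdef_inv Ppd.
exists (\sum_i bil (invmx P) (delta_mx i 0) (delta_mx i 0)) => [|x].
  by apply: sumr_ge0 => i _; apply: posdef_ge0.
rewrite sqnE mulr_suml; apply: ler_sum => i _; rewrite mulrC.
have := cauchy_schwarz x (invmx P *m delta_mx i 0) Ppd.
rewrite -bil_congr (proj1 iPd) mulVmx // mul1mx.
by rewrite {1}/bil mulmxA mulmxK // -colE !mxE.
Qed.

Lemma sqn_mulmx_le p q (M : 'M[R]_(p, q)) :
  exists2 c : R, 0 <= c & forall x, sqn (M *m x) <= c * sqn x.
Proof.
(* The squared Frobenius norm of [M]. *)
exists (\sum_i sqn (row i M)^T) => [|x]; first by apply: sumr_ge0 => i _; exact: sqn_ge0.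
rewrite sqnE mulr_suml; apply: ler_sum => i _.
have := cauchy_schwarz (row i M)^T x (sym_posdef1 q).
by rewrite {1}/bil trmxK mulmx1 -row_mul mxE.
Qed.

Lemma bil_le p (M : 'M[R]_p) :
  exists2 c : R, 0 <= c & forall x, bil M x x <= c * sqn x.
Proof.
have [c c0 Hc] := sqn_mulmx_le M; exists (1 + c) => [|x]; first exact: addr_ge0.
have e : bil 1%:M x (M *m x) = bil M x x by rewrite /bil mulmx1 mulmxA.
(* |x - M x|^2 >= 0 gives 2 x^T M x <= |x|^2 + |M x|^2. *)
have := sqn_ge0 (x + (-1) *: (M *m x)); rewrite {1}/sqn.
rewrite !(bilDl, bilDr, bilZl, bilZr) [bil _ (M *m x) x](bil_sym _ _ (sym_posdef1 _)) e -!/(sqn _).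
by have := Hc x; have s0 := sqn_ge0 x; have := mulr_ge0 c0 s0; lra.
Qed.

End QuadraticForms.

(** * Geometric decay and passage between real and complex vectors *)

Lemma geometric_lt (R : realType) (t e : R) : 0 <= t -> t < 1 -> 0 < e ->
  exists N, forall j, (N <= j)%N -> t ^+ j < e.
Proof.
move=> t0 t1 e0; have /cvgr0Pnorm_lt /(_ e e0) [N _ HN] : ((fun j => t ^+ j) @ \oo --> 0)%classic.
  by apply: cvg_expr; rewrite ger0_norm.
by exists N => j /HN /=; apply: le_lt_trans; exact: ler_norm.
Qed.

Lemma cmxM (R : realType) p q r (M : 'M[R]_(p, q)) (S : 'M[R]_(q, r)) :
  cmx (M *m S) = cmx M *m cmx S.
Proof. exact: (map_mxM (real_complex R)). Qed.

Lemma cmxB (R : realType) p q (M S : 'M[R]_(p, q)) : cmx (M - S) = cmx M - cmx S.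
Proof. exact: (map_mxB (real_complex R)). Qed.

Lemma normc_real (R : realType) (x : R) : `|Complex x 0| = Complex `|x| 0 :> R[i].
Proof. by rewrite normc_def /= expr0n addr0 sqrtr_sqr. Qed.

Lemma entry_le_cmx (R : realType) p (r : R) (y : 'cV[R]_p) :
  entry_le (Complex r 0) (cmx y) <-> entry_le r y.
Proof. by split=> yr i; have := yr i; rewrite mxE normc_real (lecR _ r). Qed.

Lemma sqn_entry_le (R : realType) p (r : R) (y : 'cV[R]_p) :
  sqn y <= r ^+ 2 -> 0 <= r -> entry_le r y.
Proof.
move=> yr r0 i; rewrite -ler_sqr ?nnegrE // real_normK ?num_real //.
apply: le_trans yr; rewrite sqnE (bigD1 i) //= lerDl sumr_ge0 // => j _.
exact: sqr_ge0.
Qed.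

Lemma entry_le_sqn (R : realType) p (r : R) (y : 'cV[R]_p) :
  entry_le r y -> sqn y <= p%:R * r ^+ 2.
Proof.
move=> yr; rewrite sqnE mulr_natl -[p in _ *+ p]card_ord -sumr_const.
apply: ler_sum => i _; rewrite -real_normK ?num_real //.
by rewrite ler_sqr ?nnegrE // (le_trans _ (yr i)).
Qed.

(** * The Riccati recursion as dynamic programming *)

Section Riccati.

Variables (R : realType) (n1 n m : nat).
Variables (E A : 'M[R]_(n1, n)) (H : 'M[R]_(m, n)).
Variables (P0 : 'M[R]_n) (Q : 'M[R]_n1) (Rm : 'M[R]_m).
Hypotheses (rankEH : \rank (col_mx E H) = n).
Hypotheses (P0pd : sym_posdef P0) (Qpd : sym_posdef Q) (Rpd : sym_posdef Rm).

Let P k := Pplus E A H P0 Q Rm k.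
Let S k := Pminus E A H P0 Q Rm k.
Let Gam k := Gamma_sm E A H P0 Q Rm k.
(** [G k *m x] is the optimal predecessor of x: the y minimizing V_k(y) + |E x - A y|^2_{Q^-1}. The
    residual left over is [w k x]. *)
Let G k : 'M[R]_n := Gam k *m A^T *m invmx Q *m E.
Let V k (x : 'cV[R]_n) := bil (invmx (P k)) x x.
Let w k (x : 'cV[R]_n) := E *m x - A *m (G k *m x).

Lemma Pminus_def k : S k = A *m P k *m A^T + Q.
Proof. by rewrite /S /P /Pminus /Pplus; case: k. Qed.

Lemma posdef_Pminus k : sym_posdef (P k) -> sym_posdef (S k).
Proof.
by move=> Ppd; rewrite Pminus_def addrC -{1}[A]trmxK; apply: posdef_congrD.
Qed.

Lemma information_posdef (X : 'M[R]_n1) : sym_posdef X ->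
  sym_posdef (E^T *m invmx X *m E + H^T *m invmx Rm *m H).
Proof.
move=> /posdef_inv Xpd; have iRpd := posdef_inv Rpd; split=> [|x x0].
  by rewrite linearD /= !trmx_mul !trmxK (proj1 Xpd) (proj1 iRpd) !mulmxA.
rewrite -[X in 0 < X]/(bil _ x x) bilDm !bil_congr.
have [Ex0|Ex0] := eqVneq (E *m x) 0; last first.
  by rewrite ltr_pwDl ?posdef_ge0 //; apply: (proj2 Xpd).
have [Hx0|Hx0] := eqVneq (H *m x) 0; last first.
  by rewrite ltr_wpDl ?posdef_ge0 //; apply: (proj2 iRpd).
have /row_fullP[B BE] : row_full (col_mx E H) by rewrite /row_full rankEH.
by case/eqP: x0; rewrite -[x]mul1mx -BE -mulmxA mul_col_mx Ex0 Hx0 col_mx0 mulmx0.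
Qed.

(** [invmx] is an involution on all matrices, so no invertibility is asked here. *)
Lemma Pplus_inv k :
  invmx (P k.+1) = E^T *m invmx (S k) *m E + H^T *m invmx Rm *m H.
Proof. exact: invmxK. Qed.

Lemma posdef_Pplus k : sym_posdef (P k).
Proof.
elim: k => [//|k /posdef_Pminus /information_posdef /posdef_inv]; exact.
Qed.

Lemma VS k x :
  V k.+1 x = bil (invmx (S k)) (E *m x) (E *m x) + bil (invmx Rm) (H *m x) (H *m x).
Proof. by rewrite /V Pplus_inv bilDm !bil_congr. Qed.

Lemma V_ge0 k x : 0 <= V k x.
Proof. exact/posdef_ge0/posdef_inv/posdef_Pplus. Qed.

Lemma invQ_ge0 x : 0 <= bil (invmx Q) x x.
Proof. exact/posdef_ge0/posdef_inv. Qed.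

Lemma invR_ge0 x : 0 <= bil (invmx Rm) x x.
Proof. exact/posdef_ge0/posdef_inv. Qed.

Lemma Gamma_inv k : invmx (Gam k) = invmx (P k) + A^T *m invmx Q *m A.
Proof. exact: invmxK. Qed.

Lemma Gamma_unit k : Gam k \in unitmx.
Proof.
rewrite unitmx_inv; apply: posdef_unit; apply: posdef_congrD; apply: posdef_inv => //.
exact: posdef_Pplus.
Qed.

(** First-order optimality condition of the minimization solved by [G k *m x]. *)
Lemma w_adjoint k x : A^T *m (invmx Q *m w k x) = invmx (P k) *m (G k *m x).
Proof.
have <- : invmx (Gam k) *m (G k *m x) - A^T *m invmx Q *m A *m (G k *m x) =
    invmx (P k) *m (G k *m x).
  by rewrite -mulmxBl Gamma_inv addrK.
rewrite /w !mulmxBr /G !mulmxA; congr (_ - _).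
by rewrite mulVmx ?Gamma_unit // mul1mx.
Qed.

(** Applying S_k = A P_k A^T + Q to Q^-1 w gives A G_k x + w = E x, by [w_adjoint]. *)
Lemma w_innovation k x : invmx (S k) *m (E *m x) = invmx Q *m w k x.
Proof.
have Su := posdef_unit (posdef_Pminus (posdef_Pplus k)).
have Pu := posdef_unit (posdef_Pplus k).
have Qu := posdef_unit Qpd.
apply: (can_inj (mulKmx Su)); rewrite mulKVmx // Pminus_def mulmxDl -!mulmxA.
by rewrite w_adjoint !mulKVmx // /w [RHS]addrC subrK.
Qed.

Lemma bil_mull p q (X : 'M[R]_p) (M : 'M[R]_(p, q)) x y :
  bil X (M *m x) y = bil 1%:M x (M^T *m (X *m y)).
Proof. by rewrite /bil trmx_mul mulmx1 !mulmxA. Qed.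

Lemma V_G k x : V k (G k *m x) = bil 1%:M (G k *m x) (A^T *m (invmx Q *m w k x)).
Proof. by rewrite w_adjoint /V /bil mulmx1 !mulmxA. Qed.

(** Write S_k^-1 E x as Q^-1 w and pair it with E x = A G_k x + w: the first summand yields V_k(G_k
    x) by [V_G], the second the weighted norm of w. *)
Lemma V_step k x : V k.+1 x =
  V k (G k *m x) + bil (invmx Q) (w k x) (w k x) + bil (invmx Rm) (H *m x) (H *m x).
Proof.
have Aw : A *m (G k *m x) + w k x = E *m x by rewrite addrC subrK.
rewrite VS; congr (_ + _); rewrite V_G -bil_mull -bilDl Aw.
by rewrite /bil -!mulmxA w_innovation.
Qed.

(** Follow the optimal predecessors back from x; in [V_step] all terms are nonnegative, so V_k(x)
    dominates each of them. *)
Lemma optimal_trajectory k x : exists X : nat -> 'cV[R]_n,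
  [/\ X k = x, V 0%N (X 0%N) <= V k x & forall j, (j < k)%N ->
     bil (invmx Q) (E *m X j.+1 - A *m X j) (E *m X j.+1 - A *m X j) <= V k x /\
     bil (invmx Rm) (H *m X j.+1) (H *m X j.+1) <= V k x].
Proof.
elim: k x => [|k IH] x; first by exists (fun=> x).
have [X [Xk X0 Xj]] := IH (G k *m x).
have le1 : V k (G k *m x) <= V k.+1 x.
  by rewrite V_step -addrA lerDl addr_ge0 ?invQ_ge0 ?invR_ge0.
exists (fun j => if j == k.+1 then x else X j).
rewrite eqxx; split=> //=; first exact: le_trans le1.
move=> j; rewrite ltnS leq_eqVlt => /orP[/eqP ->|jk].
  rewrite eqxx ltn_eqF // Xk -/(w k x) V_step; split.
    by rewrite addrAC lerDr addr_ge0 ?V_ge0 ?invR_ge0.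
  by rewrite lerDr addr_ge0 ?V_ge0 ?invQ_ge0.
rewrite eqSS (ltn_eqF jk) ltn_eqF; last by rewrite ltnS ltnW.
by have [h1 h2] := Xj j jk; split; apply: le_trans le1.
Qed.

(** S_k >= Q implies S_k^-1 <= Q^-1, which removes k from the bound. With f = S_k^-1 e and s =
    (f,f)_{S_k}, Cauchy-Schwarz for Q gives s^2 <= s |e|^2_{Q^-1}. *)
Lemma V_upper : exists2 c : R, 0 <= c & forall k x, V k.+1 x <= c * sqn x.
Proof.
have iQpd := posdef_inv Qpd; have iRpd := posdef_inv Rpd.
have [c c0 Hc] := bil_le (E^T *m invmx Q *m E + H^T *m invmx Rm *m H).
exists c => // k x; apply: le_trans (Hc x).
rewrite VS bilDm !bil_congr lerD2r; set e := E *m x.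
have Spd := posdef_Pminus (posdef_Pplus k).
have iSpd := posdef_inv Spd.
have Su := posdef_unit Spd; have Qu := posdef_unit Qpd.
set f := invmx (S k) *m e.
have sE : bil (invmx (S k)) e e = bil (S k) f f.
  by rewrite -[RHS]bil_congr (proj1 iSpd) mulVmx // mul1mx.
have Qf : bil Q f f <= bil (invmx (S k)) e e.
  rewrite sE Pminus_def bilDm -{1}[A]trmxK bil_congr lerDr.
  exact: posdef_ge0 (posdef_Pplus k).
have := cauchy_schwarz f (invmx Q *m e) Qpd.
have -> : bil Q f (invmx Q *m e) = bil (invmx (S k)) e e.
  by rewrite /bil /f trmx_mul (proj1 iSpd) !mulmxA mulmxK.
have -> : bil Q (invmx Q *m e) (invmx Q *m e) = bil (invmx Q) e e.
  by rewrite -[LHS]bil_congr (proj1 iQpd) mulVmx // mul1mx.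
rewrite expr2 => cs.
have [s0|s0] := eqVneq (bil (invmx (S k)) e e) 0; first by rewrite s0 posdef_ge0.
have spos : 0 < bil (invmx (S k)) e e by rewrite lt0r s0 posdef_ge0.
rewrite -(ler_pM2l spos); apply: le_trans cs _.
by rewrite ler_wpM2r // posdef_ge0.
Qed.

Hypothesis detect : detectable E A H.

Lemma V_coercive : exists2 c : R, 0 <= c & forall k x, sqn x <= c * V k x.
Proof.
have [c0 c00 H0] := posdef_coercive (posdef_inv P0pd).
have [cq cq0 Hq] := posdef_coercive (posdef_inv Qpd).
have [cr cr0 Hr] := posdef_coercive (posdef_inv Rpd).
have detect1 (l : R[i]) : 1 <= `|l| -> \rank (col_mx (l *: cmx E - cmx A) (cmx H)) = n.
  move=> l1; rewrite -[cmx A]scale1r; apply: detect; last by rewrite normr1.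
  by rewrite xpair_eqE oner_eq0 andbF.
(* Detectability at the pair (1, 0). *)
have /row_fullP[B] : row_full (col_mx (cmx E) (cmx H)).
  rewrite /row_full -[cmx E]scale1r -[X in col_mx X _]subr0 -[X in _ - X](scale0r (cmx A)).
  by apply/eqP/detect; rewrite ?xpair_eqE ?oner_eq0 // normr0 normr1 ler01.
rewrite -[B]hsubmxK mul_row_col => BE.
have [c c_0 Hc] := near_trajectory_bounded BE detect1.
(* A complex number that is >= 0 is real. *)
have cE : c = Complex (complex.Re c) 0.
  by move: c_0; case: (c) => a b; rewrite lecE /= => /andP[/eqP -> _].
set d := complex.Re c in cE.
have d0 : 0 <= d by move: c_0; rewrite cE (lecR 0).
(* One constant dominating the three coercivity constants, so a single radius r bounds the initial
   state and all residuals. *)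
pose C := c0 + cq + cr.
have C0 : 0 <= C by rewrite !addr_ge0.
exists (n%:R * (d ^+ 2 * C)) => [|k x]; first by rewrite !mulr_ge0 // sqr_ge0.
have CV0 : 0 <= C * V k x by rewrite mulr_ge0 // V_ge0.
pose r := Num.sqrt (C * V k x).
have r2 : r ^+ 2 = C * V k x by rewrite sqr_sqrtr.
have small p (y : 'cV[R]_p) a b : sqn y <= a * b -> b <= V k x -> 0 <= a -> a <= C ->
    entry_le r y.
  move=> yab bV a0 aC; apply: sqn_entry_le; last exact: sqrtr_ge0.
  rewrite r2; apply: le_trans yab _; apply: (@le_trans _ _ (a * V k x)).
    exact: ler_wpM2l.
  by rewrite ler_wpM2r // V_ge0.
have [X [Xk X0 Xj]] := optimal_trajectory k x.
have traj : near_trajectory (cmx E) (cmx A) (cmx H) k (Complex r 0) (fun j => cmx (X j)).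
  split; first by rewrite (lecR 0) sqrtr_ge0.
    by apply/entry_le_cmx; apply: small (H0 _) X0 _ _ => //; rewrite /C; lra.
  move=> j jk; have [h1 h2] := Xj j jk; rewrite -!cmxM -cmxB; split; apply/entry_le_cmx.
    by apply: small (Hq _) h1 _ _ => //; rewrite /C; lra.
  by apply: small (Hr _) h2 _ _ => //; rewrite /C; lra.
have := Hc _ _ _ traj; rewrite Xk cE.
have -> : Complex d 0 * Complex r 0 = Complex (d * r) 0 :> R[i].
  by rewrite -[LHS](rmorphM (real_complex R)).
move=> /entry_le_cmx /entry_le_sqn; rewrite exprMn r2 !mulrA; exact.
Qed.

Lemma V_contraction : exists t : R, [/\ 0 <= t, t < 1 &
  forall k x, V k (G k *m x) <= t * V k.+1 x].
Proof.
have [c c0 Hc] := V_coercive.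
have [c1 c10 H1] := sqn_mulmx_le (A^T *m invmx Q).
have [c2 c20 H2] := posdef_coercive (posdef_inv Qpd).
(* With v and q as set below, Cauchy-Schwarz gives v^2 <= (c v)(c1 c2 q), so v <= a q. As v + q <=
   V_{k+1}(x), it follows that (1 + a) v <= a V_{k+1}(x). *)
pose a := c * (c1 * c2).
have a0 : 0 <= a by rewrite !mulr_ge0.
exists (a / (1 + a)); split=> [||k x].
- by rewrite divr_ge0 // addr_ge0.
- by rewrite ltr_pdivrMr ?ltr_wpDr // mul1r ltrDr.
set v := V k (G k *m x); set q := bil (invmx Q) (w k x) (w k x).
have v0 : 0 <= v by exact: V_ge0.
have q0 : 0 <= q by exact: invQ_ge0.
have va : v <= a * q.
  have := cauchy_schwarz (G k *m x) (A^T *m (invmx Q *m w k x)) (sym_posdef1 _ _).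
  rewrite -V_G -/v -/(sqn _) -/(sqn _) expr2 => cs.
  have [->|vn0] := eqVneq v 0; first exact: mulr_ge0.
  have vpos : 0 < v by rewrite lt0r vn0.
  rewrite -(ler_pM2l vpos); apply: le_trans cs _.
  have -> : v * (a * q) = c * v * (c1 * (c2 * q)) by rewrite /a; ring.
  apply: ler_pM; [exact: sqn_ge0 | exact: sqn_ge0 | exact: Hc |].
  rewrite mulmxA; apply: le_trans (H1 _) _.
  exact: ler_wpM2l.
rewrite mulrAC ler_pdivlMr ?ltr_wpDr // V_step -/v -/q.
have h0 := invR_ge0 (H *m x); set h := bil _ (H *m x) _ in h0 *.
have : 0 <= a * h by exact: mulr_ge0.
by lra.
Qed.

(** [Mseq b j] is G_{b+1} ... G_{b+j}; each factor lowers the index of V by one and gains a factor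
    t. *)
Lemma V_Mseq : exists t : R, [/\ 0 <= t, t < 1 & forall b j x,
  V b.+1 (Mseq E A H P0 Q Rm b j *m x) <= t ^+ j * V (b + j).+1 x].
Proof.
have [t [t0 t1 Ht]] := V_contraction; exists t; split=> // b.
elim=> [|j IH] x; first by rewrite mul1mx expr0 mul1r addn0.
rewrite /= -!mulmxA [Gamma_sm _ _ _ _ _ _ _ *m _](_ : _ = G (b + j.+1) *m x); last first.
  by rewrite /G !mulmxA.
apply: le_trans (IH _) _; rewrite exprSr -mulrA ler_wpM2l ?exprn_ge0 //.
by rewrite -addnS; exact: Ht.
Qed.

Lemma Mseq_shift b j :
  Mseq E A H P0 Q Rm b j.+1 = G b.+1 *m Mseq E A H P0 Q Rm b.+1 j.
Proof.
elim: j => [|j IH]; first by rewrite /= addn1 mul1mx mulmx1.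
by rewrite [LHS]/= -[Mseq _ _ _ _ _ _ b j *m _ *m _ *m _ *m _]/(Mseq _ _ _ _ _ _ b j.+1)
  IH /= -!mulmxA addnS addSn.
Qed.

(** The inverse of Gamma_{b+1} cancels against the leftmost factor, leaving a prefactor independent
    of b. *)
Lemma Gamma_inv_Mseq b j : invmx (Gam b.+1) *m Mseq E A H P0 Q Rm b j.+1 =
  A^T *m invmx Q *m E *m Mseq E A H P0 Q Rm b.+1 j.
Proof.
by rewrite Mseq_shift /G !mulmxA mulVmx ?Gamma_unit // mul1mx.
Qed.

(** Coercivity of V, its contraction and its upper bound are chained; all three are uniform in the
    index. *)
Lemma sqn_Gamma_inv_Mseq : exists t c : R, [/\ 0 <= t, t < 1, 0 <= c & forall b j x,
  sqn (invmx (Gam b.+1) *m Mseq E A H P0 Q Rm b j.+1 *m x) <= c * t ^+ j * sqn x].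
Proof.
have [t [t0 t1 Ht]] := V_Mseq; have [c c0 Hc] := V_coercive.
have [d d0 Hd] := V_upper; have [a a0 Ha] := sqn_mulmx_le (A^T *m invmx Q *m E).
exists t, (a * (c * d)); split=> // [|b j x]; first by rewrite !mulr_ge0.
rewrite Gamma_inv_Mseq; set M := Mseq _ _ _ _ _ _ _ _.
have h1 := Ha (M *m x); have h2 := Hc b.+2 (M *m x).
have h3 : V b.+2 (M *m x) <= t ^+ j * V (b.+1 + j).+1 x by exact: Ht.
have h4 := Hd (b.+1 + j)%N x; have tj : 0 <= t ^+ j by exact: exprn_ge0.
have -> : a * (c * d) * t ^+ j * sqn x = a * (c * (t ^+ j * (d * sqn x))) by ring.
rewrite -(mulmxA _ M); apply: le_trans h1 _; rewrite ler_wpM2l //.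
apply: le_trans h2 _; rewrite ler_wpM2l //; apply: le_trans h3 _.
exact: ler_wpM2l.
Qed.

End Riccati.

(** * The induced norm and the conclusion *)

Lemma i2norm_le (R : realType) p q (M : 'M[R]_(p, q)) (r : R) : 0 <= r ->
  (forall x, sqn (M *m x) <= r ^+ 2 * sqn x) -> i2norm M <= r.
Proof.
move=> r0 Mr; rewrite /i2norm.
(* Without unit vectors (q = 0) the set is empty and [sup] is 0 by default. *)
have [->|/set0P ne] := eqVneq [set enorm (M *m x) | x in [set x | enorm x = 1]]%classic set0.
  by rewrite sup0.
apply: ge_sup => // _ [x /= x1 <-].
have sx : sqn x = 1.
  by rewrite -(sqr_sqrtr (sqn_ge0 x)) -enormE x1 expr1n.
rewrite enormE -[leRHS](ger0_norm r0) -sqrtr_sqr ler_wsqrtr //.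
by apply: le_trans (Mr x) _; rewrite sx mulr1.
Qed.

Unset Implicit Arguments.
Set Strict Implicit.

Theorem theorem4 (R : realType) (n1 n m : nat)
  (E A : 'M[R]_(n1, n)) (H : 'M[R]_(m, n))
  (P0 : 'M[R]_n) (Q : 'M[R]_n1) (Rm : 'M[R]_m) :
  \rank (row_mx E A) = n1 ->
  \rank (col_mx E H) = n ->
  sym_posdef P0 -> sym_posdef Q -> sym_posdef Rm ->
  detectable E A H ->
  stabilizable E A H Q Rm ->
  forall eps : R, 0 < eps ->
    exists N : nat, forall b c : nat, (N <= b)%N -> (N <= c)%N -> (1 <= c)%N ->
      i2norm (invmx (Gamma_sm E A H P0 Q Rm b.+1) *m Mmat E A H P0 Q Rm b c) < eps.
Proof.
move=> _ rankEH P0pd Qpd Rpd det _ eps eps0.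
have [t [c [t0 t1 c0 Hc]]] := sqn_Gamma_inv_Mseq rankEH P0pd Qpd Rpd det.
have r0 : 0 < eps / 2 by rewrite divr_gt0.
(* Dividing by 1 + c rather than c avoids a zero denominator. *)
have e0 : 0 < (eps / 2) ^+ 2 / (1 + c) by rewrite divr_gt0 ?exprn_gt0 // ltr_wpDr.
have [N HN] := geometric_lt t0 t1 e0.
(* For c = j + 2, [Mmat] is [Mseq b j.+1]; one factor is spent on the cancellation, leaving t^j with
   j >= N. *)
exists N.+2 => b [|[|j]] // _ jN _.
apply: (@le_lt_trans _ _ (eps / 2)); last by rewrite ltr_pdivrMr // mulr_natr mulr2n ltrDl.
apply: i2norm_le => [|x]; first exact: ltW.
apply: le_trans (Hc b j x) _; rewrite ler_wpM2r ?sqn_ge0 //.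
have := HN j jN; rewrite ltr_pdivlMr ?ltr_wpDr // => /ltW; apply: le_trans.
by rewrite mulrC ler_wpM2l ?exprn_ge0 // lerDr.
Qed.
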